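(* Let $n \geq 1$ be an integer, $m = 2^n - 1$, and $R = GF(2^n) \times GF(2^n)$. Then: (1) $ZD(R) = \Gamma(R) = K_{m,m}$. (2) $UD(R)$ is the disjoint union of one $K_m$ and $2^{n-1} - 1$ copies of $K_{m,m}$. (3) $TD(R)$ is the disjoint union of one $K_m$ and $2^{n-1}$ copies of $K_{m,m}$.
   Context: $GF(q)$ denotes the finite field with $q$ elements. For a commutative ring $A$ with $1\neq 0$ and $R = A \times A$, the dot product of $x=(x_1,x_2)$ and $y=(y_1,y_2)$ in $R$ is $x\cdot y = x_1y_1+x_2y_2 \in A$. The total dot product graph $TD(R)$ is the simple undirected graph with vertex set $R \setminus \{(0,0)\}$, in which two distinct vertices $x,y$ are adjacent if and only if $x\cdot y = 0$ in $A$. $Z(R)$ is the set of zero-divisors of $R$ (including $0$) and $U(R)$ the group of units of $R$. The zero-divisor dot product graph $ZD(R)$ is the induced subgraph of $TD(R)$ with vertex set $Z(R)\setminus\{(0,0)\}$, and the unit dot product graph $UD(R)$ is the induced subgraph of $TD(R)$ with vertex set $U(R)$. The zero-divisor graph $\Gamma(R)$ is the simple graph with vertex set $Z(R)\setminus\{0\}$, in which distinct $x,y$ are adjacent if and only if $xy=0$ (ring product in $R$). $K_m$ is the complete graph on $m$ vertices and $K_{m,m}$ the complete bipartite graph with parts of size $m$ and $m$; equality with such a graph means isomorphism, while $ZD(R)=\Gamma(R)$ is equality of graphs on the same vertex set. A graph is the disjoint union of given graphs if its vertex set is partitioned into subsets inducing (isomorphic copies of) those graphs, with no edges between vertices in different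 subsets. *)

(* Defs.v *)
From HB Require Import structures.
From mathcomp Require Import all_boot all_order all_algebra all_field.

Set Implicit Arguments.
Unset Strict Implicit.
Unset Printing Implicit Defensive.

Import GRing.Theory.
Local Open Scope ring_scope.

(* A vertex set need not exhaust the ambient type, so that a graph and its
   induced subgraphs share an ambient type and can be compared with [=].      *)
Record sgraph := SGraph {
  ground : finType;
  verts : {set ground};
  edges : {set {set ground}};
  edges_wf : [forall e in edges, (e \subset verts) && (#|e| == 2)]
}.

Definition adj (G : sgraph) (x y : ground G) : bool := [set x; y] \in edges G.

Section Constructions.

Variable T : finType.

(* The relation [r] is meant to be symmetric: [x] and [y] are joined as soon
   as [r x y] or [r y x].                                                      *)
Definition rel_edges (V : {set T}) (r : rel T) : {set {set T}} :=
  [set e : {set T} | (e \subset V) &&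
     [exists x, exists y, [&& x != y, r x y & e == [set x; y]]]].

Lemma rel_edges_wf (V : {set T}) (r : rel T) :
  [forall e in rel_edges V r, (e \subset V) && (#|e| == 2)].
Proof.
apply/forall_inP => e; rewrite inE => /andP[-> /existsP[x /existsP[y]]].
by case/and3P=> xy _ /eqP->; rewrite cards2 xy.
Qed.

Definition rel_graph (V : {set T}) (r : rel T) : sgraph :=
  SGraph (rel_edges_wf V r).

End Constructions.

Section Induced.

Variables (G : sgraph) (W : {set ground G}).

Lemma induced_wf :
  [forall e in [set e in edges G | e \subset W],
     (e \subset verts G :&: W) && (#|e| == 2)].
Proof.
apply/forall_inP => e; rewrite inE => /andP[eG eW].
by have /forall_inP/(_ e eG)/andP[eV ->] := edges_wf G; rewrite subsetI eV eW.
Qed.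

Definition induced : sgraph := SGraph induced_wf.

End Induced.

Definition graph_iso (G H : sgraph) : Prop :=
  exists f : {x | x \in verts G} -> {y | y \in verts H},
    bijective f /\ forall x y, adj (val (f x)) (val (f y)) = adj (val x) (val y).

Definition complete_graph (m : nat) : sgraph :=
  rel_graph [set: 'I_m] (fun _ _ => true).

Definition complete_bipartite (m1 m2 : nat) : sgraph :=
  rel_graph [set: 'I_m1 + 'I_m2]
    (fun x y => match x, y with
                | inl _, inr _ | inr _, inl _ => true
                | _, _ => false
                end).

Definition disjoint_union_of (G : sgraph) (I : finType)
    (H : I -> sgraph) : Prop :=
  exists P : I -> {set ground G},
  [/\ forall i j, i != j -> [disjoint P i & P j],
      \bigcup_i P i = verts G,
      forall i, graph_iso (induced (P i)) (H i)
    & forall i j x y, i != j -> x \in P i -> y \in P j -> ~~ adj x y].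

Definition one_and_copies (G : sgraph) (k : nat) (H : sgraph) :
    option 'I_k -> sgraph :=
  fun i => if i is None then G else H.

Arguments one_and_copies G k H i : clear implicits.

HB.instance Definition _ (A B : finComNzRingType) :=
  GRing.ComNzRing.on (A * B)%type.

(* 0 is a zero divisor here: take [y = 1].                                     *)
Definition zero_divisors (R : finComNzRingType) : {set R} :=
  [set x | [exists y, (y != 0) && (x * y == 0)]].

Definition zero_divisor_graph (R : finComNzRingType) : sgraph :=
  rel_graph (zero_divisors R :\ 0) (fun x y : R => x * y == 0).

Definition dotp (A : comNzRingType) (x y : A * A) : A :=
  x.1 * y.1 + x.2 * y.2.

Definition TD (A : finComNzRingType) : sgraph :=
  rel_graph [set~ (0 : A * A)] (fun x y => dotp x y == 0).

Definition ZD (A : finComNzRingType) : sgraph :=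
  @induced (TD A) (zero_divisors (A * A)%type :\ 0).

Definition UD (A : finComUnitRingType) : sgraph :=
  @induced (TD A) [set x : A * A | x \is a GRing.unit].

(* Main.v *)
Require Import Defs.
From mathcomp Require Import all_boot all_order all_algebra all_field.
From mathcomp Require Import ring.

Set Implicit Arguments.
Unset Strict Implicit.
Unset Printing Implicit Defensive.

Import GRing.Theory.
Local Open Scope ring_scope.

(** Over a field [F] of characteristic two, give a vector [x] that is off the
    line [x.1 = x.2] the coordinates [h = x.1 + x.2 != 0] (its height) and
    [u = x.1 / h] (its slope), so that [x = (u * h, (u + 1) * h)].  For two such
    vectors the dot product becomes
      [h * h' * (u * u' + (u + 1) * (u' + 1)) = h * h' * (u + u' + 1)]
    ([dotp_slope]), because [2 u u' = 0].  Hence they are adjacent exactly when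
    [u' = u + 1] ([adj_slope]): adjacency depends only on slopes, and pairs
    them off by the fixed-point-free involution [u |-> u + 1].  Each slope is
    carried by [#|F| - 1] vectors, so each orbit [{u, u + 1}] contributes one
    [K_{m,m}] ([induced_block_iso]).  On the line [x.1 = x.2] the dot product
    with [y] is [x.1 * height y], so the nonzero vectors of that line form a
    [K_m] that has no edge to the rest ([induced_diagonal_iso]).

    The three claims differ only in the slopes that occur ([slope_decomposition]).
    All slopes give the total graph, with [#|F| / 2] orbits.  A vector of
    nonzero height has [x.1 = 0] or [x.2 = 0] exactly when its slope is [0] or
    [1], so the nonzero zero-divisors form the component of the orbit
    [{0, 1}], and the units are
    the line [x.1 = x.2] together with the remaining [#|F| / 2 - 1] orbits.  On
    zero-divisors the dot product and the ring product vanish together: the two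
    terms of the dot product have product zero, so their sum is zero only if
    both are. *)

(** * Graphs and isomorphisms *)

Lemma adj_rel_graph (T : finType) (V : {set T}) (r : rel T) (x y : T) :
    symmetric r ->
  @adj (rel_graph V r) x y = [&& x \in V, y \in V, x != y & r x y].
Proof.
move=> r_sym; rewrite /adj inE subUset !sub1set /= -!andbA; congr [&& _, _ & _].
apply/existsP/andP => [[a /existsP[b /and3P[ab rab /eqP xyab]]] | [xy rxy]].
  have /orP ax : (a == x) || (a == y) by rewrite -in_set2 xyab set21.
  have /orP bx : (b == x) || (b == y) by rewrite -in_set2 xyab set22.
  case: ax bx ab rab => /eqP-> [] /eqP->; rewrite ?eqxx // => ab rab.
  by rewrite eq_sym r_sym.
by exists x; apply/existsP; exists y; rewrite xy rxy eqxx.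
Qed.

Lemma adj_induced (G : sgraph) (W : {set ground G}) (x y : ground G) :
  @adj (induced W) x y = [&& adj x y, x \in W & y \in W].
Proof. by rewrite /adj inE subUset !sub1set. Qed.

(** The well-formedness field is a boolean equation, hence proof-irrelevant. *)
Lemma sgraph_eq (T : finType) (V1 V2 : {set T}) (E1 E2 : {set {set T}})
    wf1 wf2 : V1 = V2 -> E1 = E2 ->
  @SGraph T V1 E1 wf1 = @SGraph T V2 E2 wf2.
Proof.
move=> eqV eqE; case: _ / eqV wf2 => wf2; case: _ / eqE wf2 => wf2.
by rewrite (eq_irrelevance wf1 wf2).
Qed.

(** Lets a whole graph be treated as one of its induced subgraphs, so that the
    total graph and the unit graph fall under one decomposition. *)
Lemma induced_verts (G : sgraph) : induced (verts G) = G.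
Proof.
case: G => T V E wf; apply: sgraph_eq => /=; first exact: setIid.
apply/setP => e; rewrite inE; case: (boolP (e \in E)) => //= eE.
by have /forall_inP/(_ e eE)/andP[] := wf.
Qed.

Lemma induced_induced (G : sgraph) (V W : {set ground G}) :
  V \subset W -> @induced (@induced G W) V = @induced G V.
Proof.
move=> sVW; apply: sgraph_eq => /=; first by rewrite -setIA (setIidPr sVW).
apply/setP => e; rewrite !inE -andbA; congr (_ && _).
by apply: andb_idl => /subset_trans; apply.
Qed.

Lemma induced_rel_graph (T : finType) (V W : {set T}) (r r' : rel T) :
    W \subset V -> {in W &, forall x y, r x y = r' x y} ->
  @induced (rel_graph V r) W = rel_graph W r'.
Proof.
move=> sWV rr'; apply: sgraph_eq => /=; first exact/setIidPr.
apply/setP => e; rewrite !inE andbAC.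
have [/= sub_eW|_] := boolP (e \subset W); last by rewrite andbF.
rewrite (subset_trans sub_eW sWV) /=.
apply: eq_existsb => x; apply: eq_existsb => y.
have [xy|] //= := boolP (x != y).
have [e_xy|_] := eqVneq e [set x; y]; last by rewrite !andbF.
move: sub_eW; rewrite e_xy subUset !sub1set => /andP[xW yW].
by rewrite rr'.
Qed.

(** The map goes from the model graph [H] back to [G], because the standard
    enumeration [enum_val] of a set goes that way and needs no default point,
    even for an empty set.  Equality of cardinals provides the inverse. *)
Lemma graph_iso_of_inj (G H : sgraph) (g : ground H -> ground G) :
    {in verts H, forall x, g x \in verts G} -> {in verts H &, injective g} ->
    #|verts G| = #|verts H| ->
    {in verts H &, forall x y, adj (g x) (g y) = adj x y} ->
  graph_iso G H.
Proof.
move=> gG g_inj cGH g_adj.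
pose h (y : {y | y \in verts H}) : {x | x \in verts G} :=
  exist _ (g (val y)) (gG _ (valP y)).
have h_inj : injective h.
  by move=> a b /(congr1 val) /(g_inj _ _ (valP a) (valP b)) /val_inj.
have [|f hK fK] := inj_card_bij h_inj; first by rewrite !card_sig cGH.
exists f; split=> [|x y]; first by exists h.
by rewrite -{2}[x]fK -{2}[y]fK /= g_adj ?(valP (f _)).
Qed.

Lemma graph_iso_complete (G : sgraph) (m : nat) :
    #|verts G| = m -> {in verts G &, forall x y, adj x y = (x != y)} ->
  graph_iso G (complete_graph m).
Proof.
move=> <- adjG; apply: (@graph_iso_of_inj _ (complete_graph _) enum_val).
- by move=> i _; apply: enum_valP.
- by move=> i j _ _; apply: enum_val_inj.
- by rewrite cardsT card_ord.
- move=> i j _ _; rewrite adjG ?enum_valP // adj_rel_graph // !inE andbT.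
  by rewrite (inj_eq enum_val_inj).
Qed.

Lemma graph_iso_complete_bipartite (G : sgraph) (A B : {set ground G})
    (a b : nat) :
    verts G = A :|: B -> [disjoint A & B] -> #|A| = a -> #|B| = b ->
    {in verts G &, forall x y, adj x y = ((x \in A) != (y \in A))} ->
  graph_iso G (complete_bipartite a b).
Proof.
move=> GAB dAB <- <- adjG.
pose g (s : 'I_#|A| + 'I_#|B|) :=
  match s with inl i => enum_val i | inr j => enum_val j end.
have gA s : (g s \in A) = if s is inl _ then true else false.
  by case: s => i /=; rewrite ?enum_valP // (disjointFl dAB) ?enum_valP.
have gG s : g s \in verts G.
  by rewrite GAB inE; case: s => i /=; rewrite enum_valP ?orbT.
apply: (@graph_iso_of_inj _ (complete_bipartite _ _) g) => //.
- move=> s t _ _ gst; move: (gA s); rewrite gst gA.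
  by case: s t gst => i [] j //= /enum_val_inj->.
- by rewrite cardsT card_sum !card_ord GAB cardsU disjoint_setI0 // cards0 subn0.
- move=> s t _ _; rewrite adjG // !gA adj_rel_graph; last by case=> ? [].
  by rewrite !inE /=; case: s t => i [] j /=; rewrite ?andbF.
Qed.

(** * Fixed-point-free involutions *)

(** In each orbit [{u, s u}] the representative is the member that comes first
    in the enumeration of [T]. *)
Lemma involution_transversal (T : finType) (s : T -> T) (S : {set T}) k :
    involutive s -> {in S, forall u, s u \in S} ->
    {in S, forall u, s u != u} -> #|S| = k.*2 ->
  exists r : 'I_k -> T,
    [/\ forall i, r i \in S,
        {in S, forall u, exists i, u = r i \/ u = s (r i)}
      & forall i j, r i = r j \/ r i = s (r j) -> i = j].
Proof.
move=> sK sS s_free cS.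
pose D := [set u in S | enum_rank u < enum_rank (s u)]%N.
have splitS u : u \in S -> (u \in D) || (s u \in D).
  move=> uS; rewrite !inE uS sS // sK /= -neq_ltn.
  by rewrite (inj_eq val_inj) (inj_eq enum_rank_inj) eq_sym s_free.
have Ds u : u \in D -> s u \notin D.
  rewrite !inE sK => /andP[uS lt_u]; rewrite sS //= -leqNgt; exact: ltnW.
have sI : injective s by apply: inv_inj.
have SE : S = D :|: s @: D.
  apply/setP => u; rewrite inE; apply/idP/orP => [/splitS/orP[]|].
  - by left.
  - by right; apply/imsetP; exists (s u); rewrite ?sK.
  - case=> [|/imsetP[v + ->]]; rewrite inE => /andP[] //.
    by move=> vS _; apply: sS.
have cD : #|D| = k.
  apply: double_inj; rewrite -cS SE cardsU (card_imset _ sI) disjoint_setI0.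
    by rewrite cards0 subn0 addnn.
  apply/pred0P => u /=; apply/andP => -[uD /imsetP[v vD uv]].
  by have := Ds _ vD; rewrite -uv uD.
case: k / cD cS => _; exists enum_val; split.
- by move=> i; have := enum_valP i; rewrite inE => /andP[].
- move=> u uS; case/orP: (splitS u uS) => uD.
    by exists (enum_rank_in uD u); left; rewrite enum_rankK_in.
  by exists (enum_rank_in uD (s u)); right; rewrite enum_rankK_in // sK.
- move=> i j [/enum_val_inj //|eq_ij].
  by have := Ds _ (enum_valP j); rewrite -eq_ij enum_valP.
Qed.

(** * Orthogonality in the plane over a field of characteristic two *)

Section CharacteristicTwo.

Variable F : finFieldType.
Hypothesis char2 : 2 \in [pchar F].

Implicit Types (x y : F * F) (u v : F).

Definition height x : F := x.1 + x.2.
(** Meaningful only when [height x != 0]. *)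
Definition slope x : F := x.1 / height x.
Definition diagonal : {set F * F} := [set x | (height x == 0) && (x != 0)].
Definition line u : {set F * F} := [set x | (height x != 0) && (slope x == u)].

Lemma addF u : u + u = 0. Proof. exact: addrr_pchar2. Qed.

Lemma addFK u v : u + v + v = u. Proof. by rewrite -addrA addF addr0. Qed.

Lemma addF_eq0 u v : (u + v == 0) = (u == v).
Proof. by rewrite addr_eq0 oppr_pchar2. Qed.

Lemma addF1_neq u : u + 1 != u.
Proof. by rewrite -subr_eq0 addrAC subrr add0r oner_eq0. Qed.

Lemma fst_slope x : height x != 0 -> x.1 = slope x * height x.
Proof. by move=> hx; rewrite divfK. Qed.

Lemma snd_slope x : height x != 0 -> x.2 = (slope x + 1) * height x.
Proof.
move=> hx; rewrite mulrDl -fst_slope // mul1r /height.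
by rewrite addrA addF add0r.
Qed.

Lemma dotp_height0 x y : height x = 0 -> dotp x y = x.1 * height y.
Proof.
by move/eqP; rewrite addF_eq0 => /eqP x12; rewrite /dotp -x12 -mulrDr.
Qed.

(** With slopes [s] and [t], the expansion of the dot product contains
    [s t + s t], which vanishes in characteristic two. *)
Lemma dotp_slope x y : height x != 0 -> height y != 0 ->
  dotp x y = height x * height y * (slope x + slope y + 1).
Proof.
move=> hx hy; rewrite /dotp {1}(fst_slope hx) (snd_slope hx).
rewrite {1}(fst_slope hy) (snd_slope hy).
set s := slope x; set t := slope y; set a := height x; set b := height y.
(* The two sides differ by [2 s t a b], invisible to [ring] unless added. *)
rewrite -[RHS]addr0 -(addF (s * t * a * b)); ring.
Qed.

Lemma dotpC x y : dotp x y = dotp y x.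
Proof. by rewrite /dotp mulrC [x.2 * _]mulrC. Qed.

Lemma diagonal_fst x : x \in diagonal -> x.1 != 0.
Proof.
case: x => a b; rewrite inE /height /= addF_eq0 => /andP[/eqP<-].
by apply: contraNneq => ->.
Qed.

Lemma card_diagonal : #|diagonal| = (#|F| - 1)%N.
Proof.
rewrite subn1 -(cardsC1 (0 : F)) -(card_imset [set~ 0] (f := fun a => (a, a))).
  apply: eq_card => -[a b]; rewrite inE /height /= addF_eq0.
  apply/andP/imsetP => [[/eqP<- ab0] | [c]].
    by exists a => //; rewrite !inE; apply: contraNneq ab0 => ->.
  by rewrite !inE => c0 [-> ->]; split=> //; apply: contraNneq c0 => -[->].
by move=> a b [].
Qed.

(** A vector of a given slope is determined by its height, which is an
    arbitrary nonzero scalar. *)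
Lemma card_line u : #|line u| = (#|F| - 1)%N.
Proof.
have height_point a : height (u * a, (u + 1) * a) = a.
  by rewrite /height /= mulrDl addrA addF add0r mul1r.
rewrite subn1 -(cardsC1 (0 : F)).
rewrite -(card_imset [set~ 0] (f := fun a => (u * a, (u + 1) * a))).
  apply: eq_card => x; rewrite inE; apply/andP/imsetP => [[hx /eqP<-] | [a]].
    exists (height x); rewrite ?inE //.
    by rewrite -fst_slope // -snd_slope //; case: x hx.
  by rewrite !inE => a0 ->; rewrite /slope height_point a0 mulfK.
by move=> a b /(congr1 height); rewrite !height_point.
Qed.

(** * The total dot product graph *)

Lemma adj_TD x y :
  @adj (TD F) x y = [&& x != 0, y != 0, x != y & dotp x y == 0].
Proof. by rewrite adj_rel_graph ?inE // => a b; rewrite dotpC. Qed.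

Lemma height_neq0 x : height x != 0 -> x != 0.
Proof. by apply: contraNneq => ->; rewrite /height addr0. Qed.

Lemma adj_diagonal x y : x \in diagonal -> y != 0 ->
  @adj (TD F) x y = (x != y) && (height y == 0).
Proof.
move=> Dx y0; have /[!inE]/andP[/eqP hx x0] := Dx.
rewrite adj_TD x0 y0 /= (dotp_height0 _ hx) mulf_eq0.
by rewrite (negPf (diagonal_fst Dx)).
Qed.

(** No loop can arise here, since [u + 1 != u]; this is why the condition
    [x != y] disappears. *)
Lemma adj_slope x y : height x != 0 -> height y != 0 ->
  @adj (TD F) x y = (slope x == slope y + 1).
Proof.
move=> hx hy; rewrite adj_TD !height_neq0 //= dotp_slope // !mulf_eq0.
rewrite (negPf hx) (negPf hy) /= -addrA addF_eq0.
by apply: andb_idl => /eqP s_xy; apply: contraTneq (addF1_neq (slope y));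
  rewrite -s_xy => ->; rewrite eqxx.
Qed.

(** The slopes [u] and [u + 1] give the two sides of one bipartite component. *)
Definition block u : {set F * F} := line u :|: line (u + 1).

Lemma mem_block u x :
  (x \in block u) =
    (height x != 0) && ((slope x == u) || (slope x == u + 1)).
Proof. by rewrite !inE -andb_orr. Qed.

Lemma induced_diagonal_iso :
  graph_iso (@induced (TD F) diagonal) (complete_graph (#|F| - 1)).
Proof.
have vD : verts (@induced (TD F) diagonal) = diagonal.
  by apply/setIidPr/subsetP => x; rewrite !inE => /andP[].
apply: graph_iso_complete; first by rewrite vD card_diagonal.
rewrite vD => x y Dx Dy; rewrite adj_induced Dx Dy !andbT.
have /[!inE]/andP[hy y0] := Dy.
by rewrite adj_diagonal // hy andbT.
Qed.

Lemma induced_block_iso u :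
  graph_iso (@induced (TD F) (block u))
    (complete_bipartite (#|F| - 1) (#|F| - 1)).
Proof.
have vB : verts (@induced (TD F) (block u)) = block u.
  apply/setIidPr/subsetP => x; rewrite mem_block !inE => /andP[hx _].
  exact: height_neq0.
apply: (@graph_iso_complete_bipartite (@induced (TD F) (block u))
  (line u) (line (u + 1))) => //.
- apply/pred0P => x /=; rewrite !inE; apply/negP => /andP[/andP[_ /eqP->]].
  by rewrite [u == _]eq_sym (negPf (addF1_neq u)) andbF.
- exact: card_line.
- exact: card_line.
- rewrite vB => x y Bx By; rewrite adj_induced Bx By !andbT !inE.
  move: Bx By; rewrite !mem_block => /andP[hx sx] /andP[hy sy].
  rewrite adj_slope // hx hy /=.
  case/orP: sx => /eqP->; case/orP: sy => /eqP->; rewrite ?addFK ?eqxx //.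
  + by rewrite eq_sym (negPf (addF1_neq u)).
  + by rewrite (negPf (addF1_neq u)).
  + by rewrite (negPf (addF1_neq u)).
  + by rewrite (negPf (addF1_neq u)).
Qed.

(** The components other than the diagonal are the blocks of the orbits of
    [u |-> u + 1] on [S], one for each representative. *)
Lemma slope_decomposition (S : {set F}) (k : nat) :
    {in S, forall u, u + 1 \in S} -> #|S| = k.*2 ->
  disjoint_union_of
    (@induced (TD F)
       (diagonal :|: [set x | (height x != 0) && (slope x \in S)]))
    (one_and_copies (complete_graph (#|F| - 1)) k
       (complete_bipartite (#|F| - 1) (#|F| - 1))).
Proof.
move=> S1 cS; set W := _ :|: _.
have [r [rS rP r_inj]] := @involution_transversal _ (fun u => u + 1) S k
  (fun u => addFK u 1) S1 (fun u _ => addF1_neq u) cS.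
pose P i : {set F * F} := if i is Some j then block (r j) else diagonal.
have blockW i : block (r i) \subset W.
  apply/subsetP => x; rewrite mem_block !inE => /andP[-> /= sx].
  by case/orP: sx => /eqP->; rewrite ?S1 ?rS ?orbT.
have PW i : P i \subset W by case: i => [i|] /=; rewrite ?subsetUl.
have r_slope i j x y : x \in block (r i) -> y \in block (r j) ->
    slope x = slope y \/ slope x = slope y + 1 -> i = j.
  rewrite !mem_block => /andP[_ sx] /andP[_ sy] sxy; apply: r_inj.
  have shift (a b : F) : a + 1 = b -> a = b + 1 by move=> <-; rewrite addFK.
  by case/orP: sx sxy => /eqP->; case/orP: sy => /eqP->;
    case=> [|] eq_xy; move: eq_xy; rewrite ?addFK;
    try (move/shift); rewrite ?addFK; auto.
exists P; split.
- have dD i : [disjoint block (r i) & diagonal].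
    apply/pred0P => x /=; rewrite mem_block inE.
    by case: eqVneq => //=; rewrite andbF.
  move=> [i|] [j|] //= ij; last by rewrite disjoint_sym.
  apply/pred0P => x /=; apply/negP => /andP[xi xj].
  by case/eqP: ij; congr Some; apply: r_slope xi xj _; left.
- transitivity W.
    apply/eqP; rewrite eqEsubset; apply/andP; split.
      by apply/bigcupsP => i _; apply: PW.
    apply/subsetP => x; rewrite in_setU => /orP[Dx|].
      by apply/bigcupP; exists None.
    rewrite inE => /andP[hx /rP[i sx]].
    apply/bigcupP; exists (Some i) => //=; rewrite mem_block hx.
    by case: sx => ->; rewrite eqxx ?orbT.
  apply/esym/setIidPr/subsetP => x; rewrite !inE => /orP[/andP[] //|].
  by case/andP => /height_neq0.
- move=> i; rewrite induced_induced //; case: i => [i|] /=.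
    exact: induced_block_iso.
  exact: induced_diagonal_iso.
- have nD i x y : x \in diagonal -> y \in block (r i) -> ~~ @adj (TD F) x y.
    rewrite mem_block => Dx /andP[hy _].
    by rewrite adj_diagonal ?height_neq0 // negb_and hy orbT.
  move=> i j x y ij xi yj; rewrite adj_induced negb_and; apply/orP; left.
  case: i j ij xi yj => [i|] [j|] //= ij xi yj.
  + apply: contraNN ij => xy; apply/eqP; congr Some; apply: (r_slope _ _ _ _ xi yj).
    move: xi yj xy; rewrite !mem_block => /andP[hx _] /andP[hy _].
    by rewrite adj_slope // => /eqP; right.
  + by rewrite /adj setUC; apply: nD yj xi.
  + exact: nD xi yj.
Qed.

Lemma fst_eq0 x : height x != 0 -> (x.1 == 0) = (slope x == 0).
Proof. by move=> hx; rewrite fst_slope // mulf_eq0 (negPf hx) orbF. Qed.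

Lemma snd_eq0 x : height x != 0 -> (x.2 == 0) = (slope x == 1).
Proof.
by move=> hx; rewrite snd_slope // mulf_eq0 (negPf hx) orbF addF_eq0.
Qed.

Lemma pair_eq0 x : (x == 0) = (x.1 == 0) && (x.2 == 0).
Proof. by []. Qed.

Lemma height0_snd x : height x = 0 -> x.2 = x.1.
Proof. by move/eqP; rewrite addF_eq0 => /eqP. Qed.

(** If a coordinate of [x] vanishes, a vector of the standard basis kills [x]. *)
Lemma mem_zero_divisors x :
  (x \in zero_divisors (F * F)%type) = (x.1 * x.2 == 0).
Proof.
rewrite inE mulf_eq0; apply/existsP/orP => [[y /andP[y0]] | ].
  rewrite (pair_eq0 (x * y)) /= !mulf_eq0.
  case/andP=> /orP[|y1]; [by left | case/orP=> [|y2]; [by right |]].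
  by rewrite pair_eq0 y1 y2 in y0.
case=> /eqP x0; [exists (1, 0) | exists (0, 1)];
  by rewrite !pair_eq0 /= x0 ?mul0r ?mulr0 ?eqxx ?oner_eq0.
Qed.

(** The coordinate axes have slopes [0] and [1]. *)
Lemma zero_divisors_block : zero_divisors (F * F)%type :\ 0 = block 0.
Proof.
apply/setP => x; rewrite in_setD1 mem_zero_divisors mem_block add0r pair_eq0.
have [/height0_snd->|hx] := eqVneq (height x) 0.
  by rewrite andbb mulf_eq0 orbb andNb.
by rewrite mulf_eq0 -fst_eq0 // -snd_eq0 //= -pair_eq0 height_neq0.
Qed.

Lemma units_slope :
  [set x : F * F | x \is a GRing.unit] =
    diagonal :|: [set x | (height x != 0) && (slope x \in ~: [set 0; 1])].
Proof.
apply/setP => x; rewrite !inE; transitivity ((x.1 != 0) && (x.2 != 0)).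
  by rewrite -!unitfE.
have [/height0_snd x21|hx] := eqVneq (height x) 0.
  by rewrite orbF pair_eq0 /= x21 !andbb.
by rewrite fst_eq0 // snd_eq0 // negb_or.
Qed.

Lemma verts_TD_slope :
  verts (TD F) =
    diagonal :|: [set x | (height x != 0) && (slope x \in [set: F])].
Proof.
apply/setP => x; rewrite !inE andbT.
by have [//|/height_neq0->] := eqVneq (height x) 0; rewrite ?orbF.
Qed.

(** The terms [x.1 * y.1] and [x.2 * y.2] have product zero, so if they cancel,
    each of them has square zero. *)
Lemma ZD_zero_divisor_graph : ZD F = zero_divisor_graph (F * F)%type.
Proof.
apply: induced_rel_graph => [|x y].
  by apply/subsetP => x; rewrite !inE => /andP[].
rewrite !in_setD1 !mem_zero_divisors => /andP[_ /eqP x12] /andP[_ /eqP y12].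
rewrite pair_eq0 /= /dotp.
have p0 : (x.1 * y.1) * (x.2 * y.2) = 0 by rewrite mulrACA x12 mul0r.
apply/idP/andP => [|[/eqP-> /eqP->]]; last by rewrite addr0.
rewrite addF_eq0 => /eqP eq12.
by move/eqP: p0; rewrite eq12 mulf_eq0 orbb => ->.
Qed.

End CharacteristicTwo.

Theorem theorem2p1 (n : nat) (hn : (1 <= n)%N) (F : finFieldType)
    (hF : #|F| = (2 ^ n)%N) :
  let m := (2 ^ n - 1)%N in
  [/\ ZD F = zero_divisor_graph (F * F)%type
        /\ graph_iso (zero_divisor_graph (F * F)%type) (complete_bipartite m m),
      disjoint_union_of (UD F)
        (one_and_copies (complete_graph m)
           (2 ^ (n - 1) - 1)%N (complete_bipartite m m))
    & disjoint_union_of (TD F)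
        (one_and_copies (complete_graph m)
           (2 ^ (n - 1))%N (complete_bipartite m m))].
Proof.
have char2 : 2 \in [pchar F] by apply: card_finPcharP hF _.
have cF : #|F| = (2 ^ (n - 1)).*2 by rewrite hF subn1 -mul2n -expnS prednK.
have cU : #|~: [set 0; 1 : F]| = (2 ^ (n - 1) - 1).*2.
  by rewrite cardsCs setCK cards2 eq_sym oner_eq0 cF doubleB.
move=> m; rewrite /m -hF; split.
- split; first exact: ZD_zero_divisor_graph.
  rewrite -ZD_zero_divisor_graph // /ZD zero_divisors_block //.
  exact: induced_block_iso.
- rewrite /UD units_slope //; apply: slope_decomposition => // u.
  by rewrite !inE addF_eq0 // -[u + 1 == 1]subr_eq0 addrK orbC.
- rewrite -[TD F]induced_verts verts_TD_slope //.
  by apply: slope_decomposition; rewrite ?cardsT // => u; rewrite !inE.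
Qed.
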